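(* Let $(X,r)$ be a finite square-free non-degenerate braided set (not necessarily $\mathrm{SD}$) such that $|X|>1$ and the number of $r$-orbits in $X^2$ is $2|X|-1$. Then $|X|$ is a prime number. Furthermore, its derived solution $(X,r')$ is, up to isomorphism, one of the following braided sets: (1) $|X|$ is an odd prime and $(X,r')$ is the braided set associated to the dihedral quandle (of order $|X|$); (2) $|X|=2$ and $(X,r')$ is the trivial braided set; (3) $X=\{1,2,3\}$ and $r'(x,y)=(\sigma'_x(y),x)$ with $\sigma'_1=\sigma'_2=\mathrm{id}$, $\sigma'_3=(1,2)$. Moreover, $\dim_K(A(K,X,r)_m)=\dim_K(A(K,X,r')_m)$ for every nonnegative integer $m$ and any field $K$.
   Context: A quadratic set $(X,r)$ is a nonempty set $X$ with a bijective map $r\colon X\times X\to X\times X$, written $r(x,y)=(\sigma_x(y),\gamma_y(x))$. It is non-degenerate if all $\sigma_x$ and $\gamma_x$ are bijective, square-free if $r(x,x)=(x,x)$ for all $x\in X$, and $\mathrm{SD}$ if all $\gamma_y=\mathrm{id}$, i.e. $r(x,y)=(\sigma_x(y),x)$. It is a braided set if $r_1r_2r_1=r_2r_1r_2$ on $X^3$, where $r_1=r\times \mathrm{id}_X$ and $r_2=\mathrm{id}_X\times r$. The $r$-orbits in $X^2$ are the orbits of the group $\langle r\rangle$ acting on $X^2$. The derived solution of a non-degenerate braided set $(X,r)$ is $(X,r')$ with $r'(x,y)=(\sigma'_x(y),x)$, where $\sigma'_x(y)=\gamma_x\bigl(\sigma_{\gamma_y^{-1}(x)}(y)\bigr)$;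 it is a non-degenerate $\mathrm{SD}$ braided set. An isomorphism $(X,r)\to(Y,s)$ is a bijection $f\colon X\to Y$ with $(f\times f)\circ r=s\circ(f\times f)$. The braided set associated to the dihedral quandle of order $n$ is $(\mathbb{Z}/(n),r)$ with $r(i,j)=(2i-j,i)$. The trivial braided set on $X$ is given by $r(x,y)=(y,x)$ for all $x,y\in X$. The structure algebra is $A(K,X,r)=K\langle X\mid xy=uv \text{ whenever } r(x,y)=(u,v)\rangle$; it is graded by word length, and $A(K,X,r)_m$ is the $K$-span of all products $x_1\cdots x_m$ with $x_i\in X$. *)

(* Defs.v *)
From HB Require Import structures.
From mathcomp Require Import all_boot perm all_algebra.
From mathcomp Require Import monalg.
From mathcomp Require boolp.

Set Implicit Arguments.
Unset Strict Implicit.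
Unset Printing Implicit Defensive.

Import GRing.Theory.
Local Open Scope ring_scope.
Local Open Scope quotient_scope.

(* A finite quadratic set is a permutation r : {perm X * X}, which coerces to
   a function.  The notions below are stated for functions, so that they also
   apply to the derived solution, which is bijective only as a theorem. *)
Section BraidedSets.

Variables (X : finType) (r : X * X -> X * X).

(* r (x, y) = (sigma x y, gamma y x) *)
Definition sigma (x y : X) : X := (r (x, y)).1.
Definition gamma (y x : X) : X := (r (x, y)).2.

Definition non_degenerate : Prop :=
  forall x : X, bijective (sigma x) /\ bijective (gamma x).

Definition square_free : Prop := forall x : X, r (x, x) = (x, x).

Definition r1 (t : X * X * X) : X * X * X :=
  let: (x, y, z) := t in ((r (x, y)).1, (r (x, y)).2, z).

Definition r2 (t : X * X * X) : X * X * X :=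
  let: (x, y, z) := t in (x, (r (y, z)).1, (r (y, z)).2).

Definition braided : Prop := r1 \o r2 \o r1 =1 r2 \o r1 \o r2.

(* finv f is the inverse of f whenever f is injective. *)
Definition derived (p : X * X) : X * X :=
  let: (x, y) := p in (gamma x (sigma (finv (gamma y) x) y), x).

End BraidedSets.

Definition isomorphic (X Y : finType) (r : X * X -> X * X)
    (s : Y * Y -> Y * Y) : Prop :=
  exists2 f : X -> Y, bijective f &
    forall x y : X, (f (r (x, y)).1, f (r (x, y)).2) = s (f x, f y).

Definition trivial_sol (X : finType) (p : X * X) : X * X := (p.2, p.1).

(* Only meaningful for 1 < n, as 'Z_0 and 'Z_1 are both 'Z_2. *)
Definition dihedral_sol (n : nat) (p : 'Z_n * 'Z_n) : 'Z_n * 'Z_n :=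
  (p.1 *+ 2 - p.2, p.1).

(* The elements 0, 1, 2 of 'I_3 stand for 1, 2, 3: sigma_1 = sigma_2 = id and
   sigma_3 is the transposition (1 2). *)
Definition transposition_sol (p : 'I_3 * 'I_3) : 'I_3 * 'I_3 :=
  (if p.1 == 2 then tperm 0 1 p.2 else p.2, p.1).

Inductive ideal_gen (R : nzRingType) (S : R -> Prop) : R -> Prop :=
| ideal_gen_in x of S x : ideal_gen S x
| ideal_gen0 : ideal_gen S 0
| ideal_genD x y of ideal_gen S x & ideal_gen S y : ideal_gen S (x + y)
| ideal_genMl a x of ideal_gen S x : ideal_gen S (a * x)
| ideal_genMr a x of ideal_gen S x : ideal_gen S (x * a).

Definition ideal_pred (R : nzRingType) (S : R -> Prop) :=
  fun x : R => boolp.asbool (ideal_gen S x).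

Section PresentedAlgebra.

Variables (K : nzRingType) (F : lalgType K) (S : F -> Prop).

Local Notation I := (ideal_pred S).

Lemma ideal_predP x : reflect (ideal_gen S x) (x \in I).
Proof. exact: boolp.asboolP. Qed.

Fact ideal_pred_zmod_closed : zmod_closed I.
Proof.
split=> [|x y /ideal_predP Ix /ideal_predP Iy]; apply/ideal_predP.
  exact: ideal_gen0.
by apply: ideal_genD => //; rewrite -mulN1r; apply: ideal_genMl.
Qed.

HB.instance Definition _ := GRing.isZmodClosed.Build F I ideal_pred_zmod_closed.

Definition ideal_zmod : zmodClosed F := GRing.ZmodClosed.clone F I _.

Definition alg_quot : Type := Quotient.quot ideal_zmod.

HB.instance Definition _ := ZmodQuotient.on alg_quot.

Let equivP (x y : F) : reflect (ideal_gen S (x - y)) (x == y %[mod alg_quot]).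
Proof. by rewrite -(Quotient.idealrBE ideal_zmod); apply: ideal_predP. Qed.

Definition quot_one : alg_quot := \pi_alg_quot 1.
Definition quot_mul (a b : alg_quot) : alg_quot := \pi_alg_quot (repr a * repr b).
Definition quot_scale (c : K) (a : alg_quot) : alg_quot := \pi_alg_quot (c *: repr a).

Let reprB x : ideal_gen S (repr (\pi_alg_quot x) - x).
Proof. by apply/equivP; rewrite reprK. Qed.

Lemma pi_quot_mul x y : \pi_alg_quot (x * y) = quot_mul (\pi_alg_quot x) (\pi_alg_quot y).
Proof.
apply/esym/eqP/equivP; set x' := repr _; set y' := repr _.
have ->: x' * y' - x * y = x' * (y' - y) + (x' - x) * y.
  by rewrite mulrBr mulrBl addrA subrK.
by apply: ideal_genD; [apply: ideal_genMl|apply: ideal_genMr]; apply: reprB.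
Qed.

Lemma pi_quot_scale c x : \pi_alg_quot (c *: x) = quot_scale c (\pi_alg_quot x).
Proof.
apply/esym/eqP/equivP; rewrite -scalerBr -[_ - _]mul1r scalerAl.
exact/ideal_genMl/reprB.
Qed.

Let pi_quotD x y : \pi_alg_quot (x + y) = \pi_alg_quot x + \pi_alg_quot y.
Proof. exact: (Quotient.pi_add ideal_zmod). Qed.

Let pi_ind (P : alg_quot -> Prop) :
  (forall x, P (\pi_alg_quot x)) -> forall a, P a.
Proof. by move=> P_pi a; rewrite -[a]reprK; apply: P_pi. Qed.

Fact quot_mulA : associative quot_mul.
Proof.
elim/pi_ind=> x; elim/pi_ind=> y; elim/pi_ind=> z.
by rewrite -!pi_quot_mul mulrA.
Qed.

Fact quot_mul1l : left_id quot_one quot_mul.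
Proof. by elim/pi_ind=> x; rewrite -pi_quot_mul mul1r. Qed.

Fact quot_mul1r : right_id quot_one quot_mul.
Proof. by elim/pi_ind=> x; rewrite -pi_quot_mul mulr1. Qed.

Fact quot_mulDl : left_distributive quot_mul +%R.
Proof.
elim/pi_ind=> x; elim/pi_ind=> y; elim/pi_ind=> z.
by rewrite -pi_quotD -!pi_quot_mul -pi_quotD mulrDl.
Qed.

Fact quot_mulDr : right_distributive quot_mul +%R.
Proof.
elim/pi_ind=> x; elim/pi_ind=> y; elim/pi_ind=> z.
by rewrite -pi_quotD -!pi_quot_mul -pi_quotD mulrDr.
Qed.

(* 1 != 0 fails if S generates F, hence a pzRingType and not an lalgType. *)
HB.instance Definition _ := GRing.Zmodule_isPzRing.Build alg_quot
  quot_mulA quot_mul1l quot_mul1r quot_mulDl quot_mulDr.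

Fact quot_scaleA a b v : quot_scale a (quot_scale b v) = quot_scale (a * b) v.
Proof. by elim/pi_ind: v => x; rewrite -!pi_quot_scale scalerA. Qed.

Fact quot_scale1 : left_id 1 quot_scale.
Proof. by elim/pi_ind=> x; rewrite -pi_quot_scale scale1r. Qed.

Fact quot_scaleDr : right_distributive quot_scale +%R.
Proof.
by move=> a; elim/pi_ind=> x; elim/pi_ind=> y;
  rewrite -pi_quotD -!pi_quot_scale -pi_quotD scalerDr.
Qed.

Fact quot_scaleDl v : {morph quot_scale^~ v : a b / a + b}.
Proof.
by move=> a b; elim/pi_ind: v => x;
  rewrite -!pi_quot_scale -pi_quotD scalerDl.
Qed.

HB.instance Definition _ := GRing.Zmodule_isLmodule.Build K alg_quot
  quot_scaleA quot_scale1 quot_scaleDr quot_scaleDl.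

Lemma alg_quot_scalerAl (a : K) (u v : alg_quot) : a *: (u * v) = a *: u * v.
Proof.
elim/pi_ind: u => x; elim/pi_ind: v => y.
rewrite -[_ * _]pi_quot_mul -[LHS]pi_quot_scale scalerAl.
by rewrite pi_quot_mul pi_quot_scale.
Qed.

End PresentedAlgebra.

Section StructureAlgebra.

Variables (K : fieldType) (X : finType) (r : X * X -> X * X).

(* The free algebra K<X> is the monoid algebra of the free monoid on X. *)
Definition free_var (x : X) : {malg K[{fmonom X}]} := << fmu x >>.

Definition structure_relation (p : {malg K[{fmonom X}]}) : Prop :=
  exists x y : X,
    p = free_var x * free_var y
        - free_var (r (x, y)).1 * free_var (r (x, y)).2.

Definition structure_algebra : Type := alg_quot structure_relation.

HB.instance Definition _ := GRing.PzRing.on structure_algebra.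
HB.instance Definition _ := GRing.Lmodule.on structure_algebra.
HB.instance Definition _ := ZmodQuotient.on structure_algebra.

Definition structure_var (x : X) : structure_algebra :=
  \pi_structure_algebra (free_var x).

End StructureAlgebra.

Section Dimension.

Variables (K : fieldType) (V : lmodType K).

Definition span_of (I : finType) (v : I -> V) (u : V) : Prop :=
  exists c : I -> K, u = \sum_i c i *: v i.

Definition lin_indep (I : finType) (v : I -> V) : Prop :=
  forall c : I -> K, \sum_i c i *: v i = 0 -> forall i, c i = 0.

Definition has_dim (W : V -> Prop) (d : nat) : Prop :=
  exists b : 'I_d -> V, lin_indep b /\ forall u, W u <-> span_of b u.

End Dimension.

Definition graded_part (K : fieldType) (X : finType) (r : X * X -> X * X)
    (m : nat) : structure_algebra K r -> Prop :=
  span_of (fun w : m.-tuple X => \prod_(x <- w) structure_var K r x).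
Arguments graded_part K [X] r m _.

(* Main.v *)
Require Import Defs.
From mathcomp Require Import all_boot perm all_algebra.
From mathcomp Require Import fingroup action cyclic pgroup sylow.
From mathcomp Require Import finmap monalg zify.

Set Implicit Arguments.
Unset Strict Implicit.
Unset Printing Implicit Defensive.

(** Write g_z for gamma z : x |-> gamma_z(x) and r'(x, y) = (tau_x(y), x) for
    the derived solution.  The guitar map
      (x_1, ..., x_m) |-> (g_{x_m} ... g_{x_2} x_1, ..., g_{x_m} x_(m-1), x_m)
    is a bijection of X^m that conjugates r acting on two adjacent letters into
    r' acting on the same two letters ([guitar_act_at]).  For m = 2 it shows
    that r and r' have equally many orbits; for m = 3 that r' is braided, so
    that x |> y := tau_x(y) is a quandle, idempotent because r is square-free.
    The component of degree m of a structure algebra has for dimension the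
    number of classes of words of length m under these moves
    ([graded_part_dim]), so the dimensions for r and r' agree.  It remains to
    classify the quandles whose braiding R(x, y) = (x |> y, x) has 2n - 1
    orbits, where n = |X|.

    Let t x be the permutation y |-> x |> y, and call the classes of equality
    of t x fibers.  The product t_x t_y is constant on an R-orbit.  This makes
    it easy to exhibit 2n - 1 pairs in distinct orbits once a representative of
    each fiber is chosen: the n diagonal pairs, the pairs of any other point
    with the representative of its fiber, and the pairs of one representative
    x0 with all the others.  Hence these pairs meet all orbits
    ([rep_pair_cover]).  Varying the representatives, a fiber has at most two
    points, and the orbit of any pair outside the fibers has members of each
    first component ([orbit_meets]).  So the inner group G = <t x | x> is
    transitive, unless it preserves every fiber.

    If G preserves the fibers, the t x commute, and there are at most two
    fibers, with at most two points each: an inspection leaves the trivial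
    quandle on two points and the transposition quandle.

    If G is transitive, the fibers are points ([transitive_inj]): two points
    with the same translation would yield a central involution without fixed
    points, a power of an even permutation, hence even, which a count of an
    orbit shows to be a product of an odd number of transpositions.  Then
    each orbit off the diagonal has exactly n elements, one for each first
    component, and an inner permutation with two fixed points is trivial.  By
    Burnside's count G has n - 1 derangements, and they are the n - 1 products
    t_x t_y, where x is fixed and y <> x.  If n is odd, they all have order n,
    so that they form with 1 a cyclic group, whose nontrivial elements all
    have order n: n is prime.  The t x are involutions inverting this cyclic
    group, which acts regularly: the quandle is dihedral.  If n is even, then
    G contains an involution; it is a derangement, hence a product t_x t_y of
    order n / 2.  So n = 4, which is excluded by following two orbits. *)

(** * Orbits of permutations *)

Section Permutations.

Local Open Scope group_scope.

Lemma conjgg (gT : finGroupType) (x : gT) : x ^ x = x.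
Proof. by rewrite conjgE mulKg. Qed.

Lemma swap_pow (T : finType) (s : {perm T}) a b k : s a = b -> s b = a ->
  (s ^+ k) a = if odd k then b else a.
Proof.
move=> ab ba; elim: k => [|k IHk]; first by rewrite perm1.
by rewrite expgSr permM IHk /=; case: odd.
Qed.

Lemma card_porbit_dvdn (T : finType) (s : {perm T}) p m :
  (s ^+ m) p = p -> #|porbit s p| %| m.
Proof.
move=> sm; set c := #|porbit s p|.
have c0 : 0 < c by rewrite lt0n card_porbit_neq0.
have sc k : (s ^+ (k * c)) p = p.
  elim: k => [|k IHk]; first by rewrite perm1.
  by rewrite mulSn expgD permM [in X in (s ^+ (k * c)) X]permX iter_porbit.
have : (s ^+ (m %% c)) p = p by rewrite -{2}sm {2}(divn_eq m c) expgD permM sc.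
have := uniq_traject_porbit s p; rewrite -/c => /uniqP-/(_ p) uc e.
rewrite /dvdn; apply/eqP/uc; rewrite ?inE ?size_traject ?ltn_pmod //.
by rewrite !nth_traject ?ltn_pmod // -!permX e expg0 perm1.
Qed.

Lemma card_porbits_conj (T : finType) (s u : {perm T}) :
  #|porbits (s ^ u)| = #|porbits s|.
Proof.
have porbitJ x : porbit (s ^ u) (u x) = u @: porbit s x.
  apply/setP=> y; apply/porbitP/imsetP => [[i ->] | [_ /porbitP[i ->] ->]].
    by exists ((s ^+ i) x); rewrite ?mem_porbit // -conjXg permJ.
  by exists i; rewrite -conjXg permJ.
have -> : porbits (s ^ u) = (fun A : {set T} => u @: A) @: porbits s.
  apply/setP=> A; apply/imsetP/imsetP => [[x _ ->] | [_ /imsetP[x _ ->] ->]].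
    by exists (porbit s (u^-1 x)); rewrite ?imset_f // -porbitJ permKV.
  by exists (u x).
by rewrite card_imset //; apply/imset_inj/perm_inj.
Qed.

Lemma uniq_cover (T : finType) (s : seq T) :
  uniq s -> size s = #|T| -> forall x, x \in s.
Proof.
move=> us ss x; apply: contraT => xs; have := max_card (mem (x :: s)).
by rewrite (card_uniqP _) /= ?xs // ss ltnn.
Qed.

End Permutations.

(** * The braiding of a finite quandle *)

Section Quandle.

Local Open Scope group_scope.

Variables (X : finType) (t : X -> {perm X}).
Hypothesis t_idem : forall x, t x x = x.
Hypothesis t_dist : forall x y, t (t x y) = t y ^ t x.

Definition quandle_fun (p : X * X) := (t p.1 p.2, p.1).

Lemma quandle_fun_inj : injective quandle_fun.
Proof.
by move=> [x y] [z w] [/= txy xz]; move: txy; rewrite xz => /perm_inj->.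
Qed.

Definition quandle_sol := perm quandle_fun_inj.
Local Notation R := quandle_sol.

Lemma quandle_solE x y : R (x, y) = (t x y, x).
Proof. by rewrite permE. Qed.

(** Since [R] has finite order, its orbits are reached by forward steps. *)
Lemma quandle_orbit_ind (P : X * X -> Prop) p :
  P p -> (forall x y, P (x, y) -> P (t x y, x)) ->
  forall q, q \in porbit R p -> P q.
Proof.
move=> Pp PR q /porbitP[i ->]; elim: i => [|i IHi]; first by rewrite perm1.
rewrite expgSr permM; case: ((R ^+ i) p) IHi => x y /PR.
by rewrite quandle_solE.
Qed.

(** The relation t_(x |> y) t_x = t_x t_y. *)
Lemma quandle_orbit_mul p q :
  q \in porbit R p -> t q.2 * t q.1 = t p.2 * t p.1.
Proof.
move: q; apply: quandle_orbit_ind => //= x y <-.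
by rewrite t_dist -conjgC.
Qed.

(** The translations [t (t x y)] and [t x] are the conjugates of [t y] and
    [t x] by [t x]. *)
Lemma quandle_orbit_teq p q :
  q \in porbit R p -> (t q.1 == t q.2) = (t p.1 == t p.2).
Proof.
move: q; apply: quandle_orbit_ind => //= x y <-; rewrite t_dist.
by rewrite -{2}(conjgg (t x)) (inj_eq (@conjg_inj _ _)) eq_sym.
Qed.

Lemma quandle_orbit_same p q : t p.1 = t p.2 ->
  q \in porbit R p -> q = p \/ q = (p.2, p.1).
Proof.
case: p => x y /= txy; move: q; apply: quandle_orbit_ind; first by left.
move=> _ _ [] [-> ->].
  by right; rewrite txy t_idem.
by left; rewrite -txy t_idem.
Qed.

Lemma quandle_distl x y z : t (t x y) (t x z) = t x (t y z).
Proof. by rewrite t_dist permJ. Qed.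

(** [R ^+ 2] acts on an orbit through the product of translations that is
    constant on that orbit. *)
Lemma quandle_sol_even x y i :
  (R ^+ i.*2) (x, y) = (((t y * t x) ^+ i) x, ((t y * t x) ^+ i) y).
Proof.
elim: i x y => [|i IHi] x y; first by rewrite !perm1.
rewrite doubleS !expgS !permM !quandle_solE {}IHi; set g := _ * _.
suffices -> : g = t y * t x.
  by have := quandle_distl x y x; rewrite !t_idem => ->.
by rewrite /g (t_dist (t x y)) -conjgC t_dist -conjgC.
Qed.

Lemma quandle_sol_odd x y i :
  (R ^+ i.*2.+1) (x, y) = (((t y * t x) ^+ i) (t x y), ((t y * t x) ^+ i) x).
Proof. by rewrite expgS permM quandle_solE quandle_sol_even t_dist -conjgC. Qed.

Lemma quandle_orbit_diag x q : q \in porbit R (x, x) -> q = (x, x).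
Proof. by case/(quandle_orbit_same (p := (x, x)) erefl). Qed.

Lemma quandle_orbit_cancel x y z : (x, z) \in porbit R (x, y) -> t z = t y.
Proof. by move/quandle_orbit_mul/mulIg. Qed.

(** * Counting the orbits *)

Hypothesis card_orbits : #|porbits R| = (2 * #|X| - 1)%N.

Section Representatives.

Variables (x0 : X) (rep : X -> X).
Hypotheses (t_rep : forall x, t (rep x) = t x).
Hypotheses (rep_eq : forall x y, t x = t y -> rep x = rep y).
Hypotheses (rep0 : rep x0 = x0).

(** A choice of #|X| - 1 pairs off the diagonal, indexed by [x != x0], that lie
    in pairwise distinct orbits; [rep] selects a point in each fiber of [t]. *)
Definition rep_pair x := if rep x == x then (x0, x) else (x, rep x).

Lemma rep_pair_same x : x != x0 ->
  (t (rep_pair x).1 == t (rep_pair x).2) = (rep x != x).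
Proof.
move=> xx0; rewrite /rep_pair.
case: (rep x =P x) => /= [rx | _]; last by rewrite t_rep eqxx.
by apply: contraNF xx0 => /eqP/rep_eq; rewrite rep0 rx => ->.
Qed.

Lemma rep_pair_diag x y : y != x0 -> (x, x) \notin porbit R (rep_pair y).
Proof.
move=> yx0; rewrite porbit_sym; apply/negP => /quandle_orbit_diag.
rewrite /rep_pair; case: eqP => [_ [e1 e2] | ne [e1 e2]].
  by rewrite e1 e2 eqxx in yx0.
by case: ne; rewrite e2.
Qed.

(** Whether the two components of a pair have equal translations is an
    invariant of its orbit, which separates the two sorts of pairs.  Within one
    fiber an orbit is {(x, y), (y, x)}; across fibers the constant product
    t_x0 t_y determines the fiber of [y]. *)
Lemma rep_pair_inj x y : x != x0 -> y != x0 ->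
  rep_pair x \in porbit R (rep_pair y) -> x = y.
Proof.
move=> xx0 yx0 xy; have := quandle_orbit_teq xy.
rewrite !rep_pair_same // => /(canLR negbK); rewrite negbK => rxy.
move: xy; rewrite /rep_pair rxy; case: (rep y =P y) rxy => [ry /eqP rx | ne rx].
  by move/quandle_orbit_cancel => txy; rewrite -rx -ry; apply: rep_eq.
move=> h; case: (quandle_orbit_same _ h) => /= [|[]|[e1 e2]]; rewrite ?t_rep //.
by case: ne; rewrite -e2 e1; apply: rep_eq; rewrite t_rep.
Qed.

(** With the diagonal, these are 2 #|X| - 1 distinct orbits, hence all of
    them. *)
Lemma rep_pair_cover x y : x != y ->
  exists2 w, w != x0 & rep_pair w \in porbit R (x, y).
Proof.
move=> xy.
pose D := [set porbit R (z, z) | z : X].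
pose E := [set porbit R (rep_pair w) | w in [set~ x0]].
have DE : D :&: E = set0.
  apply/setP => A; rewrite !inE; apply/andP => -[/imsetP[z _ ->] /imsetP[w]].
  rewrite !inE => /(rep_pair_diag z)/negP nz /eqP.
  by rewrite eq_porbit_mem; apply: nz.
have cD : #|D| = #|X|.
  rewrite card_imset // => u v /eqP.
  rewrite eq_porbit_mem => /quandle_orbit_diag.
  by case.
have cE : #|E| = #|X|.-1.
  rewrite card_in_imset ?cardsC1 // => u v; rewrite !inE => u0 v0 /eqP.
  by rewrite eq_porbit_mem; apply: rep_pair_inj.
have /eqP eDE : D :|: E == porbits R.
  rewrite eqEcard; apply/andP; split.
    by apply/subsetP=> A /setUP[] /imsetP[z _ ->]; apply: imset_f.
  by rewrite card_orbits cardsU DE cards0 cD cE; lia.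
have : porbit R (x, y) \in D :|: E by rewrite eDE imset_f.
case/setUP => /imsetP[w].
  move=> _ /eqP; rewrite eq_porbit_mem => /quandle_orbit_diag[e1 e2].
  by rewrite e1 e2 eqxx in xy.
by rewrite !inE => w0 /eqP; rewrite eq_sym eq_porbit_mem; exists w.
Qed.

End Representatives.

(** Prescribing two representatives, [a] as the base point and [b] in another
    fiber, is what allows a variation of the representatives. *)
Definition rep_of a b x :=
  if t x == t a then a else if t x == t b then b
  else odflt x [pick z | t z == t x].

Lemma t_rep_of a b x : t (rep_of a b x) = t x.
Proof.
rewrite /rep_of; case: eqP => [-> //|_]; case: eqP => [-> //|_].
by case: pickP => [z /eqP|].
Qed.

Lemma rep_of_eq a b x y : t x = t y -> rep_of a b x = rep_of a b y.
Proof.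
move=> txy; rewrite /rep_of txy; do 2!case: ifP => // _.
by case: pickP => [//|/(_ y)]; rewrite eqxx.
Qed.

Lemma rep_of1 a b : rep_of a b a = a.
Proof. by rewrite /rep_of eqxx. Qed.

Lemma rep_of2 a b : t a != t b -> rep_of a b b = b.
Proof. by rewrite /rep_of eqxx eq_sym => /negPf->. Qed.

(** If the fiber is represented by [x], the orbit {(y, z), (z, y)} has to
    contain a pair with a component [x]. *)
Lemma fiber_le2 x y z : t x = t y -> t x = t z -> x != y -> x != z -> y = z.
Proof.
move=> txy txz xy xz; apply/eqP/negPn/negP => yz.
have [w w0] :=
  rep_pair_cover (t_rep_of x x) (@rep_of_eq x x) (rep_of1 x x) yz.
move=> /[dup] /quandle_orbit_teq; rewrite /= -txy -txz eqxx.
rewrite (rep_pair_same (t_rep_of x x) (@rep_of_eq x x) (rep_of1 x x)) // => rw.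
rewrite /rep_pair (negPf rw) => /quandle_orbit_same.
case=> [|[ew]|[ew]]; rewrite /= -?txy -?txz //.
  by rewrite /rep_of ew -txy eqxx => xz'; rewrite xz' eqxx in xz.
by rewrite /rep_of ew -txz eqxx => xy'; rewrite xy' eqxx in xy.
Qed.

Lemma fiber_pair u u' z :
  u' != u -> t u' = t u -> t z = t u -> z = u \/ z = u'.
Proof.
move=> u'u tu' tz; have [->|zu] := eqVneq z u; first by left.
by right; apply: (@fiber_le2 u); rewrite // eq_sym.
Qed.

(** The last part lets the orbit meet (a, b) itself as soon as it is known to
    meet some (a, z) with [z] in the fiber of [b], since [b] may be taken as the
    representative of that fiber. *)
Lemma orbit_meets x y a b : t x != t y -> t a != t b ->
  exists z, [/\ (a, z) \in porbit R (x, y), t z != t a & t z = t b -> z = b].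
Proof.
move=> txy tab; have xy : x != y by apply: contraNneq txy => ->.
have [w w0] :=
  rep_pair_cover (t_rep_of a b) (@rep_of_eq a b) (rep_of1 a b) xy.
move=> /[dup] /quandle_orbit_teq /=; rewrite (negPf txy).
rewrite (rep_pair_same (t_rep_of a b) (@rep_of_eq a b) (rep_of1 a b)) //.
move/negbFE/eqP => rw; rewrite /rep_pair rw eqxx => aw; exists w; split=> //.
  by have := quandle_orbit_teq aw; rewrite /= (negPf txy) eq_sym => ->.
by move/(@rep_of_eq a b); rewrite rw rep_of2.
Qed.

Lemma t_differs x y z : t x != t y -> exists b, t z != t b.
Proof.
have [<-|] := eqVneq (t x) (t z); first by exists y.
by rewrite eq_sym; exists x.
Qed.

Lemma orbit_through x y a : t x != t y ->
  exists b, (a, b) \in porbit R (x, y).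
Proof.
move=> txy; have [c tac] := t_differs a txy.
by have [b [ab _ _]] := orbit_meets txy tac; exists b.
Qed.

(** * Inner permutations *)

Definition inn_gens := [set t x | x : X].
Local Notation G := <<inn_gens>>.

Lemma inn_t x : t x \in G.
Proof. by rewrite mem_gen ?imset_f. Qed.

Lemma inn_aut h x : h \in G -> t (h x) = t x ^ h.
Proof.
pose A := [set k : {perm X} | [forall y, t (k y) == t y ^ k]].
have gA : group_set A.
  apply/group_setP; split.
    by rewrite inE; apply/forallP=> y; rewrite perm1 conjg1.
  move=> k l; rewrite !inE => /forallP kA /forallP lA; apply/forallP=> y.
  by rewrite permM (eqP (lA _)) (eqP (kA _)) conjgM.
suffices : G \subset Group gA.
  by move/subsetP=> GA /GA; rewrite inE => /forallP/(_ x)/eqP.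
rewrite gen_subG; apply/subsetP=> _ /imsetP[y _ ->]; rewrite inE.
by apply/forallP=> z; rewrite t_dist.
Qed.

Lemma inn_orbit_const u : (forall x, t x = t u) -> G \subset 'C[u | 'P].
Proof.
move=> tu; rewrite gen_subG; apply/subsetP=> _ /imsetP[y _ ->].
by apply/astab1P; rewrite /= /aperm tu t_idem.
Qed.

(** All points are first components in the orbit of [(x, y)], so every [t z] is
    a word in [t x] and [t y]. *)
Lemma inn_central h x y : t x != t y ->
  commute h (t x) -> commute h (t y) -> forall k, k \in G -> commute h k.
Proof.
move=> txy hx hy; suffices hC : [set h] \subset 'C(inn_gens).
  by rewrite -cent_gen in hC; move=> k kG; apply: (centsP hC); rewrite ?inE.
apply/centsP=> _ /set1P-> _ /imsetP[z _ ->].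
have [w zw] := orbit_through z txy.
pose P (q : X * X) := commute h (t q.1) /\ commute h (t q.2).
suffices [] : P (z, w) by [].
move: zw; apply: quandle_orbit_ind => // a b' [/= ha hb].
split=> //; rewrite t_dist; apply: commuteM; first exact: commuteV.
exact: commuteM.
Qed.

(** The components of the members of the orbit of (h x, x) stay in the orbit
    of [x] under the inner group, and their first components exhaust [X]. *)
Lemma conn_transitive x h : h \in G -> t (h x) != t x ->
  [transitive G, on setT | 'P].
Proof.
move=> hG thx; apply/imsetP; exists x => //.
apply/esym/eqP; rewrite eqEsubset subsetT.
apply/subsetP=> z _.
have [w zw] := orbit_through z thx.
pose P (q : X * X) := q.1 \in orbit 'P G x /\ q.2 \in orbit 'P G x.
suffices [] : P (z, w) by [].
move: zw; apply: quandle_orbit_ind.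
  by split; [exact: (mem_orbit 'P) | exact: orbit_refl].
move=> a b' [/= ax bx]; split=> //=.
exact: orbit_trans (mem_orbit 'P b' (inn_t a)) bx.
Qed.

Hypothesis X_gt1 : 1 < #|X|.

Lemma trivial_quandle_card : (forall x, t x = 1) -> #|X| = 2.
Proof.
move=> t1; apply/eqP; rewrite eqn_leq X_gt1 andbT leqNgt.
apply/negP=> /card_gt2P[x [y [z [_ [xy yz zx]]]]].
by move/eqP: yz; apply; apply: (@fiber_le2 x); rewrite ?t1 // eq_sym.
Qed.

Definition two_trivial := #|X| = 2 /\ forall x, t x = 1.
Definition three_transposition := exists a b c : X,
  [/\ uniq [:: a; b; c], forall x, x \in [:: a; b; c],
      t a = 1, t b = 1 & t c = tperm a b].

(** * Quandles whose inner group preserves the fibers *)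

Section Intransitive.

Hypothesis t_inn : forall x h, h \in G -> t (h x) = t x.

Lemma commJ_t x y : t y ^ t x = t y.
Proof. by rewrite -t_dist t_inn ?inn_t. Qed.

(** The translations now commute, so [R] merely exchanges the translations of
    the two components of a pair. *)
Lemma two_values u v z : t u != t v -> t z = t u \/ t z = t v.
Proof.
move=> tuv; have [w zw] := orbit_through z tuv.
pose P (q : X * X) :=
  (t q.1, t q.2) = (t u, t v) \/ (t q.1, t q.2) = (t v, t u).
have : P (z, w).
  move: zw; apply: quandle_orbit_ind; first by left.
  by move=> x y; rewrite /P => -[] [/= <- <-]; [right|left];
    rewrite /= t_dist commJ_t.
by case=> -[-> _]; [left|right].
Qed.

Lemma intransitive_transposition u u' v : t u != t v -> u' != u -> t u' = t u ->
  (forall z, t z = t v -> z = v) -> three_transposition.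
Proof.
move=> tuv u'u tu' fv.
have fu z := fiber_pair (z := z) u'u tu'.
have uv : u != v by apply: contraNneq tuv => ->.
have u'v : u' != v by apply: contraNneq tuv => <-; rewrite tu'.
have all3 z : z \in [:: u; u'; v].
  rewrite !inE; have [/fu[]->|/fv->] := two_values z tuv; by rewrite eqxx ?orbT.
have tuu' : t u u' = u' by rewrite -tu' t_idem.
have t_fix x : t x v = v by apply: fv; rewrite t_inn ?inn_t.
have tu1 : t u = 1.
  apply/permP=> z; rewrite perm1; move: (all3 z).
  by rewrite !inE => /or3P[]/eqP->.
exists u, u', v; split=> //=; last first.
- have tvu : t v u = u'.
    have [||//] := fu (t v u); first by rewrite t_inn ?inn_t.
    move=> vu; case/negP: tuv; rewrite tu1; apply/eqP/permP=> z; rewrite perm1.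
    move: (all3 z); rewrite !inE => /or3P[]/eqP->; rewrite ?vu ?t_fix //.
    have [||->//] := fu (t v u'); first by rewrite t_inn ?inn_t.
    by rewrite -{1}vu => /perm_inj /eqP; rewrite (negPf u'u).
  have tvu' : t v u' = u.
    have [||] := fu (t v u'); [by rewrite t_inn ?inn_t | by [] |].
    by rewrite -{2}tvu => /perm_inj /eqP; rewrite (negPf u'u).
  apply/permP=> z; move: (all3 z); rewrite !inE => /or3P[]/eqP->.
  + by rewrite tpermL. + by rewrite tpermR. + by rewrite tpermD.
- by rewrite tu'.
by rewrite !inE negb_or eq_sym u'u uv u'v.
Qed.

(** On a pair of points in different fibers, an even power of [R] acts as a
    power of g = t v * t u on both components. As the orbit meets (u', v) and
    (u, v'), g exchanges the points of each fiber; but then each power of g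
    moves both components or neither. *)
Lemma intransitive_no22 u u' v v' : t u != t v -> u' != u -> t u' = t u ->
  v' != v -> t v' = t v -> False.
Proof.
move=> tuv u'u tu' v'v tv'.
have fu z := fiber_pair (z := z) u'u tu'.
have fv z := fiber_pair (z := z) v'v tv'.
set g := t v * t u.
have gG : g \in G by rewrite groupM ?inn_t.
have even_orbit a b : t a = t u -> t b = t v ->
  exists k, (g ^+ k) u = a /\ (g ^+ k) v = b.
  move=> ta tb; have tab : t a != t b by rewrite ta tb.
  have [z [az tza /(_ _)zb]] := orbit_meets tuv tab.
  have {}zb : z = b.
    apply: zb; have [tz|->] := two_values z tuv; last by rewrite tb.
    by rewrite tz ta eqxx in tza.
  rewrite zb in az; have /porbitP[i] := az; rewrite -[i]odd_double_half.
  case: odd => /=;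
    rewrite ?add0n ?add1n ?quandle_sol_odd ?quandle_sol_even => -[ea eb].
    by case/negP: tab; rewrite ta eb t_inn ?groupX.
  by exists i./2.
have gu : g u = u'.
  have [||//] := fu (g u); first by rewrite t_inn.
  have [k [ku' _]] := even_orbit u' v tu' erefl => gu.
  by move: ku'; rewrite permX_fix // => e; rewrite e eqxx in u'u.
have gu' : g u' = u.
  have [||] := fu (g u'); [by rewrite t_inn | by [] |].
  by rewrite -{2}gu => /perm_inj /eqP; rewrite (negPf u'u).
have gv : g v = v'.
  have [||//] := fv (g v); first by rewrite t_inn.
  have [k [_ kv']] := even_orbit u v' erefl tv' => gv.
  by move: kv'; rewrite permX_fix // => e; rewrite e eqxx in v'v.
have gv' : g v' = v.
  have [||] := fv (g v'); [by rewrite t_inn | by [] |].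
  by rewrite -{2}gv => /perm_inj /eqP; rewrite (negPf v'v).
have [k [ku kv]] := even_orbit u v' erefl tv'.
move: ku kv; rewrite (swap_pow _ gu gu') (swap_pow _ gv gv').
by case: odd => e1 e2; move: u'u v'v; rewrite ?e1 ?e2 eqxx.
Qed.

Lemma intransitive_quandle : two_trivial \/ three_transposition.
Proof.
have [/forallP tc | ] := boolP [forall x, forall y, t x == t y].
  left; suffices t1 x : t x = 1 by split=> //; apply: trivial_quandle_card.
  by apply/permP=> y; rewrite (eqP (forallP (tc x) y)) t_idem perm1.
case/forallPn=> u /forallPn[v tuv]; right.
have [/existsP[u' /andP[u'u /eqP tu']] | nu] :=
    boolP [exists u', (u' != u) && (t u' == t u)].
  apply: (intransitive_transposition tuv u'u tu') => z tz.
  apply/eqP/negPn/negP => zv.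
  exact: (intransitive_no22 tuv u'u tu' zv tz).
have fu z : t z = t u -> z = u.
  move=> tz; apply/eqP; apply: contraNT nu => zu; apply/existsP; exists z.
  by rewrite zu tz eqxx.
have tvu : t v != t u by rewrite eq_sym.
have [/existsP[v' /andP[v'v /eqP tv']] | nv] :=
    boolP [exists v', (v' != v) && (t v' == t v)].
  exact: (intransitive_transposition tvu v'v tv').
have fv z : t z = t v -> z = v.
  move=> tz; apply/eqP; apply: contraNT nv => zv; apply/existsP; exists z.
  by rewrite zv tz eqxx.
case/negP: (tuv); apply/eqP/permP => z.
by have [/fu-> | /fv->] := two_values z tuv;
  [rewrite t_idem; apply/esym/fu | rewrite t_idem; apply/fv];
  rewrite t_inn ?inn_t.
Qed.

End Intransitive.

(** * Connected quandles: the translations are distinct *)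

Section Transitive.

Hypothesis t_trans : [transitive G, on setT | 'P].

Lemma inn_move x y : exists2 h, h \in G & y = h x.
Proof.
by have [h hG ->] := atransP2 t_trans (in_setT x) (in_setT y); exists h.
Qed.

Lemma t_nonconst u : exists y, t u != t y.
Proof.
apply/existsP; apply: contraTT X_gt1 => /existsPn tu; rewrite -leqNgt -cardsT.
have /subsetP Gu : G \subset 'C[u | 'P].
  by apply: inn_orbit_const => x; apply/esym/eqP/negPn/tu.
rewrite -(cards1 u) subset_leq_card //; apply/subsetP=> x _.
have [h /Gu/astab1P/= hu ->] := inn_move u x; by rewrite inE -[X in _ == X]hu.
Qed.

(** The set of fixed points of a central element is stable under [G]. *)
Lemma central_fix h x : (forall k, k \in G -> commute h k) -> h x = x -> h = 1.
Proof.
move=> hC hx; apply/permP=> z; rewrite perm1.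
by have [k /hC hk ->] := inn_move x z; rewrite -permM -hk permM hx.
Qed.

Lemma inn_commute h x : h \in G -> t (h x) = t x -> commute h (t x).
Proof.
by move=> hG; rewrite inn_aut // => e; rewrite /commute [RHS]conjgC e.
Qed.

(** Suppose [t u = t v] with [u != v], and take [y] outside this fiber. Then
    (v, y) is R^i (u, y) for some i. For even i, a power of g = t y * t u sends
    [u] to [v] and fixes [y]; it is central, hence trivial. For odd i, z = g^i
    is a central involution that exchanges the two points of each fiber. It is
    an even permutation since g is a product of two conjugates; on the other
    hand the orbit of (u, y) has 2 #|X| elements, a divisor of 4 i, so z is a
    product of an odd number #|X| / 2 of transpositions. *)
Lemma transitive_inj : injective t.
Proof.
move=> u v tuv; apply/eqP/negPn/negP => uv.
have [y tuy] := t_nonconst u.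
set O := porbit R (u, y); set g := t y * t u.
have gG i : g ^+ i \in G by rewrite groupX ?groupM ?inn_t.
(* The orbit of (u, y) meets (v, y): the constant product gives [t z = t y]. *)
have [i vyi] : exists i, (v, y) = (R ^+ i) (u, y).
  have tvy : t v != t y by rewrite -tuv.
  have [z [vz _ /(_ _)zy]] := orbit_meets tuy tvy.
  apply/porbitP; rewrite -{1}zy //.
  by have := quandle_orbit_mul vz; rewrite /= tuv => /mulIg.
have odd_i : odd i.
  apply/negPn/negP => ev; move: vyi.
  rewrite -[i]odd_double_half (negPf ev) add0n.
  rewrite quandle_sol_even -/g; set h := _ ^+ _ => -[hu hy].
  have hC : forall k, k \in G -> commute h k.
    by apply: (inn_central tuy); apply: inn_commute; rewrite ?gG -?hu -?hy.
  by move: uv; rewrite hu (central_fix hC (esym hy)) perm1 eqxx.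
pose k := i./2; have Di : i = k.*2.+1 by rewrite -[i]odd_double_half odd_i.
have [e1 e2] : (v, y) = ((g ^+ k) (t u y), (g ^+ k) u).
  by rewrite vyi Di quandle_sol_odd.
pose z := g ^+ i.
have [zu zy] : z u = v /\ z y = (g ^+ k) v.
  have := quandle_sol_even u y i.
  rewrite -addnn expgD permM -vyi Di quandle_sol_odd -Di.
  by rewrite -tuv -/g -e1 => -[-> ->].
have zC : forall k, k \in G -> commute z k.
  apply: (inn_central tuy); apply: inn_commute; rewrite ?gG ?zu ?zy //.
  by rewrite [in RHS]e2 !inn_aut ?gG // tuv.
have z1 x : z x != x.
  by apply: contra_neq uv => /(central_fix zC) zz; rewrite -zu zz perm1.
have tz x : t (z x) = t x.
  by rewrite inn_aut ?gG // conjgE -zC ?inn_t // mulKg.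
have zz x : z (z x) = x.
  by apply/esym/(@fiber_le2 (z x)); rewrite ?tz ?z1 // eq_sym z1.
have cX : #|X| = (#|porbits z| * 2)%N.
  rewrite -cardsT; apply: card_uniform_partition; last first.
    rewrite (_ : porbits z = [set orbit 'P <[z]> x | x in setT]).
      by apply: orbit_partition; apply/actsP => a _ x; rewrite !inE.
    by apply/setP=> A; apply/imsetP/imsetP=> -[x _ ->]; exists x;
      rewrite ?porbitE ?inE.
  move=> _ /imsetP[x _ ->].
  rewrite (_ : porbit z x = [set x; z x]) ?cards2 1?eq_sym ?z1 //.
  apply/setP=> w; rewrite !inE; apply/porbitP/orP.
    case=> j ->; rewrite (swap_pow _ erefl (zz x)).
    by case: odd; rewrite eqxx; auto.
  by case=> /eqP->; [exists 0%N; rewrite perm1 | exists 1%N].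
have even_z : odd_perm z = false.
  have godd : odd_perm g = false.
    rewrite /g; have [h hG ->] := inn_move u y.
    by rewrite inn_aut // odd_permM odd_permJ addbb.
  rewrite /z; elim: (i) => [|j IHj]; first by rewrite odd_perm1.
  by rewrite expgS odd_permM IHj godd.
(* Each first component occurs with both points of one fiber. *)
have cO : #|O| = (#|X| * 2)%N.
  have -> : #|O| = \sum_(a : X) #|[set b | (a, b) \in O]|.
    rewrite -sum1_card; under [RHS]eq_bigr => a _ do rewrite -sum1_card.
    by rewrite pair_big_dep /=; apply: eq_bigl => -[a b]; rewrite !inE.
  rewrite -sum_nat_const; apply: eq_bigr => a _.
  have [c tac] := t_nonconst a.
  have [b [ab tba _]] := orbit_meets tuy tac.
  rewrite (_ : finset _ = [set b; z b]) ?cards2 1?eq_sym ?z1 //.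
  apply/setP=> d; rewrite !inE.
  have dO d' : t d' = t b -> (a, d') \in O.
    move=> td; have tad : t a != t d' by rewrite td eq_sym.
    have [b' [ab' _ /(_ _)bd]] := orbit_meets tuy tad.
    rewrite -bd // td.
    by have := quandle_orbit_mul ab; rewrite -(quandle_orbit_mul ab') => /mulIg.
  apply/idP/orP => [ad|]; last by case=> /eqP->; apply: dO; rewrite ?tz.
  have td : t d = t b.
    by have := quandle_orbit_mul ab; rewrite -(quandle_orbit_mul ad) => /mulIg.
  have [->|db] := eqVneq d b; [by left | right; apply/eqP].
  by apply: (@fiber_le2 b); rewrite ?tz ?td // eq_sym ?z1 // db.
have /dvdnP[m] : #|O| %| i.*2.*2.
  apply: card_porbit_dvdn; rewrite quandle_sol_even -/g -addnn expgD -/z.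
  by rewrite !permM !zz.
(* With #|X| = 2 q and q even, #|O| = 4 q would divide 4 i for the odd i. *)
have /negbT/even_halfK Dq : odd #|porbits z| = false.
  by rewrite -even_z /odd_perm cX oddM andbF.
rewrite cO cX -Dq Di -!muln2 => /eqP.
have -> : (m * (#|porbits z|./2 * 2 * 2 * 2) = m * #|porbits z|./2 * 8)%N.
  by lia.
by move: (m * _)%N => c /eqP; lia.
Qed.

(** * Connected quandles: orbits and derangements *)

Local Notation n := #|X|.

Lemma orbit_uniq p a b c :
  (a, b) \in porbit R p -> (a, c) \in porbit R p -> b = c.
Proof.
move=> ab ac; apply: transitive_inj.
by have := quandle_orbit_mul ab; rewrite -(quandle_orbit_mul ac) => /mulIg.
Qed.

Lemma orbit_first x y a : x != y ->
  exists2 b, (a, b) \in porbit R (x, y) & a != b.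
Proof.
move=> xy; have [c tac] := t_nonconst a.
have txy : t x != t y by rewrite (inj_eq transitive_inj).
have [b [ab tba _]] := orbit_meets txy tac; exists b => //.
by apply: contraNneq tba => ->.
Qed.

Lemma card_quandle_orbit x y : x != y -> #|porbit R (x, y)| = n.
Proof.
move=> xy; set O := porbit _ _.
rewrite -(card_in_imset (f := fst) (D := mem O)); last first.
  by move=> [a b] [_ c] /= ab /[swap] /= <- ac; rewrite (orbit_uniq ab ac).
rewrite -cardsT; congr #|pred_of_set _|; apply/setP=> a; rewrite inE.
by have [b ab _] := orbit_first a xy; apply/imsetP; exists (a, b).
Qed.

(** An inner permutation fixing [x] and [y] commutes with [t x] and [t y],
    which generate [G]. *)
Lemma stab_two h x y : h \in G -> x != y -> h x = x -> h y = y -> h = 1.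
Proof.
move=> hG xy hx hy; apply: (central_fix _ hx).
have txy : t x != t y by rewrite (inj_eq transitive_inj).
by apply: (inn_central txy); apply: inn_commute; rewrite ?hx ?hy.
Qed.

Lemma t_free x y : x != y -> t x y != y.
Proof.
move=> xy; apply: contra_neq xy => txy; apply/eqP/negPn/negP => xy.
have tx1 : t x = 1 by apply: (stab_two _ xy); rewrite ?inn_t.
case/eqP: xy; apply: transitive_inj; rewrite tx1.
by have [h hG ->] := inn_move x y; rewrite inn_aut // tx1 conj1g.
Qed.

Lemma quandle_gt2 : 2 < n.
Proof.
have /card_gt1P[x [y [_ _ xy]]] := X_gt1.
apply/card_gt2P; exists x, y, (t x y); split=> //; split=> //.
  by rewrite eq_sym t_free.
by rewrite -{2}(t_idem x) (inj_eq perm_inj) eq_sym.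
Qed.

Lemma orbit_period x y p i : x != y -> p \in porbit R (x, y) ->
  ((R ^+ i) p == p) = (n %| i).
Proof.
move=> xy pO; have cp : #|porbit R p| = n.
  by move: pO; rewrite -eq_porbit_mem => /eqP ->; rewrite card_quandle_orbit.
apply/eqP/idP => [/card_porbit_dvdn|]; rewrite -cp // => /dvdnP[k ->].
by rewrite mulnC expgM permX_fix // permX iter_porbit.
Qed.

(** The orbit of [(x, y)] contains a pair (z, w), where the product of
    translations is the same, and the first component determines a member of
    the orbit: the k-th power of the product fixes [z] exactly if R^(2 k) fixes
    (z, w). *)
Lemma prod_pow_fix x y k z : x != y ->
  (((t y * t x) ^+ k) z == z) = (n %| k.*2).
Proof.
move=> xy; have [w zw _] := orbit_first z xy.
rewrite -(orbit_period _ xy zw) quandle_sol_even.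
have /= -> := quandle_orbit_mul zw.
apply/eqP/eqP => [e|[]//].
have : (R ^+ k.*2) (z, w) \in porbit R (x, y).
  by rewrite -eq_porbit_mem porbit_perm eq_porbit_mem.
rewrite quandle_sol_even; have /= -> := quandle_orbit_mul zw.
by rewrite e => h; rewrite (orbit_uniq h zw).
Qed.

Lemma prod_pow_eq1 x y k : x != y ->
  ((t y * t x) ^+ k == 1) = (n %| k.*2).
Proof.
move=> xy; apply/eqP/idP => [e|nk].
  by rewrite -(prod_pow_fix _ x xy) e perm1.
by apply/permP => z; rewrite perm1; apply/eqP; rewrite prod_pow_fix.
Qed.

Definition derangements := [set h in G | [forall x, h x != x]].
Local Notation D := derangements.

(** Burnside's count for the transitive group [G]: the identity fixes #|X|
    points, any other element that is no derangement fixes exactly one by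
    [stab_two], and the numbers of fixed points add up to #|G|. *)
Lemma card_derangements : #|D| = n.-1.
Proof.
have actG : [acts G, on setT | 'P] by apply/actsP => a _ x; rewrite !inE.
have := Frobenius_Cauchy actG.
rewrite (_ : [set orbit 'P G x | x in setT] = [set setT]) ?cards1 ?mul1n;
  last first.
  apply/setP=> A; rewrite inE; have /card_gt1P[x _] := X_gt1.
  apply/imsetP/eqP => [[z _ ->] | ->]; first exact: (atransP t_trans).
  by exists x; rewrite ?(atransP t_trans).
have DG : D \subset G by apply/subsetP=> h; rewrite inE => /andP[].
(* The right-hand side corrects the value 1, valid off [D], at the identity. *)
have fixE h : h \in G ->
    #|'Fix_(setT | 'P)[h]| = (((h == 1%g) * n.-1)%N + (h \in G :\: D)%g)%N.
  move=> hG; have [->|h1] := eqVneq h 1.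
    rewrite (_ : 'Fix_(setT | 'P)[1] = setT); last first.
      by apply/setP=> x; rewrite !inE sub1set inE /= /aperm perm1 eqxx.
    rewrite mul1n cardsT (_ : (1 \in G :\: D) = true).
      by rewrite addn1 prednK ?(ltnW X_gt1).
    rewrite !inE group1 andbT /=; have /card_gt1P[x _] := X_gt1.
    by apply/forallPn; exists x; rewrite perm1 eqxx.
  rewrite mul0n add0n !inE hG andbT /=; case: (boolP [forall x, _]) => /= hD.
    apply/eqP; rewrite cards_eq0; apply/eqP/setP=> x; rewrite !inE sub1set inE.
    by apply/negbTE/(forallP hD).
  case/forallPn: hD => x /negPn/eqP hx.
  rewrite (_ : 'Fix_(setT | 'P)[h] = [set x]) ?cards1 //.
  apply/setP=> y; rewrite !inE sub1set inE /= /aperm.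
  apply/eqP/eqP => [hy|->//]; apply/eqP/negPn/negP => yx.
  by case/eqP: h1; apply: (stab_two hG yx).
under eq_bigr => h hG do rewrite fixE //.
rewrite big_split /= (bigD1 1) ?group1 //= eqxx mul1n.
rewrite big1 => [|h /andP[_ /negPf->]//].
rewrite (_ : \sum_(h in G) (h \in G :\: D) = #|G :\: D|); last first.
  rewrite -sum1_card [LHS]big_mkcond [RHS]big_mkcond; apply: eq_bigr => h _.
  by rewrite !inE; case: (h \in G); rewrite ?andbF // andbT; case: ifP.
rewrite cardsDS // addn0 => eG; apply: (@addnI (#|G| - #|D|)).
by rewrite subnK ?subset_leq_card // -{1}eG addnC.
Qed.

Lemma prod_derangement x y : x != y -> t y * t x \in D.
Proof.
move=> xy; rewrite inE groupM ?inn_t //=; apply/forallP=> z.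
have := prod_pow_fix 1 z xy; rewrite expg1 => ->.
by apply/negP => /dvdn_leq-/(_ isT); have := quandle_gt2; lia.
Qed.

(** For fixed [x], the products [t y * t x] are #|X| - 1 distinct
    derangements. *)
Lemma derangement_prod x d : d \in D -> exists2 y, x != y & d = t y * t x.
Proof.
have -> : D = [set t y * t x | y in [set~ x]].
  apply/esym/eqP; rewrite eqEcard card_derangements.
  rewrite card_in_imset ?cardsC1 ?leqnn ?andbT.
    apply/subsetP=> _ /imsetP[y + ->]; rewrite in_setC1 => yx.
    by apply: prod_derangement; rewrite eq_sym.
  by move=> y1 y2 _ _ /mulIg /transitive_inj.
by case/imsetP=> y; rewrite !inE => yx ->; exists y; rewrite // eq_sym.
Qed.

Lemma derangement_pow_fix d k z : d \in D -> ((d ^+ k) z == z) = (n %| k.*2).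
Proof.
have /card_gt1P[x _] := X_gt1 => /(derangement_prod x)[y xy ->].
exact: prod_pow_fix.
Qed.

Lemma derangement_pow_eq1 d k : d \in D -> (d ^+ k == 1) = (n %| k.*2).
Proof.
have /card_gt1P[x _] := X_gt1 => /(derangement_prod x)[y xy ->].
exact: prod_pow_eq1.
Qed.

(** The order of the transitive group [G] is a multiple of #|X|, so [G] has an
    involution.  The number of its fixed points has the parity of #|X|, so it is
    not one, and it is at most one by [stab_two]: the involution is a
    derangement, so its order is #|X| / 2. *)
Lemma even_card4 : ~~ odd n -> n = 4.
Proof.
move=> ev; have two_n : 2 %| n by rewrite dvdn2.
have /(Cauchy (isT : prime 2))[h hG h2] : 2 %| #|G|.
  by apply: dvdn_trans two_n _; rewrite -cardsT; apply: (atrans_dvd t_trans).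
have hD : h \in D.
  rewrite inE hG /=; apply/forallP=> x; apply/negP=> /eqP hx.
  have h1 : h != 1 by rewrite -order_eq1 h2.
  have hp : 2.-group <[h]> by rewrite /pgroup -orderE h2.
  have acth : [acts <[h]>, on setT | 'P] by apply/actsP => a _ y; rewrite !inE.
  have := pgroup_fix_mod hp acth.
  rewrite (_ : 'Fix_(setT | 'P)(<[h]>) = [set x]).
    by rewrite cards1 cardsT (eqP two_n).
  rewrite setTI afix_cycle.
  apply/setP=> y; rewrite !inE sub1set inE /= /aperm.
  apply/eqP/eqP => [hy|->//]; apply/eqP/negPn/negP => yx.
  by case/eqP: h1; apply: (stab_two hG yx).
have : h ^+ 2 == 1 by rewrite -h2 expg_order.
rewrite derangement_pow_eq1 // => n4.
have := dvdn_leq _ n4 => /(_ isT); have := quandle_gt2.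
by move: n4 ev; case: (n) => [|[|[|[|[|m]]]]].
Qed.

Lemma orbit4_firsts a b : n = 4 -> a != b ->
  uniq [:: a; t a b; t (t a b) a; t (t (t a b) a) (t a b)].
Proof.
move=> n4 ab; set s := [:: _; _; _; _].
have seqE : s = [seq ((R ^+ i) (a, b)).1 | i <- iota 0 4].
  by rewrite /s /= !permX /= !quandle_solE.
rewrite seqE map_inj_in_uniq ?iota_uniq // => i j.
rewrite !mem_iota /= => i4 j4.
wlog ij : i j i4 j4 / i <= j => [th eij|].
  by case/orP: (leq_total i j) => h; [|apply/esym]; apply: th.
have pi k : (R ^+ k) (a, b) \in porbit R (a, b) by rewrite mem_porbit.
move=> eij; have e2 : (R ^+ i) (a, b) = (R ^+ j) (a, b).
  move: (pi i) (pi j) eij.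
  case: ((R ^+ i) _) => u v; case: ((R ^+ j) _) => u' v' /=.
  by move=> h h' e; rewrite -e in h' *; rewrite (orbit_uniq h h').
have := orbit_period (j - i) ab (pi i).
rewrite -permM -expgD subnKC // e2 eqxx n4.
move=> /esym h4; have : (j - i)%N = 0%N.
  apply/eqP; rewrite -leqn0 leqNgt; apply/negP=> /dvdn_leq/(_ h4); lia.
lia.
Qed.

(** On four points, [t x] is a 3-cycle y -> z -> w -> y, and the four first
    components in an orbit off the diagonal are distinct.  Conjugation by [t x]
    transports a value of [t y x] to one of [t z x].  If [t y x = z], the orbit
    of (x, w) forces [t z y = w = t z x]; if [t y x = w], the orbit of (x, y)
    forces [t y z = w = t y x]; both contradict injectivity. *)
Lemma odd_card : odd n.
Proof.
apply/negPn/negP => /even_card4 n4.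
have /card_gt1P[x [y [_ _ xy]]] := X_gt1.
have t_x u : x != u -> t x u != x.
  by apply: contra_neq => e; apply: (@perm_inj _ (t x)); rewrite e t_idem.
pose z := t x y; pose w := t x z.
have xz : x != z by rewrite eq_sym t_x.
have xw : x != w by rewrite eq_sym t_x.
have zy : z != y by apply: t_free.
have wz : w != z by apply: t_free.
(* If [t x] exchanged [y] and [z], it would fix the fourth point. *)
have wy : w != y.
  apply/eqP => wy; have [v] : exists v, v \notin [:: x; y; z].
    apply/existsP; rewrite -negb_forall; apply/negP=> /forallP all3.
    have /subset_leq_card : X \subset [:: x; y; z] by apply/subsetP.
    by rewrite leqNgt n4 (leq_ltn_trans (card_size _)).
  rewrite !inE !negb_or => /and3P[vx vy vz].
  have := @uniq_cover _ [:: x; y; z; v]; rewrite n4 /= !inE !negb_or.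
  rewrite xy xz (eq_sym x v) (eq_sym y z) zy (eq_sym y v) (eq_sym z v) vx vy vz.
  have n2 : t x v != y by rewrite -wy /w (inj_eq perm_inj).
  have n3 : t x v != z by rewrite /z (inj_eq perm_inj).
  have n1 : t x v != x by rewrite t_x // eq_sym.
  have n4' : t x v != v by rewrite t_free // eq_sym.
  move=> /(_ isT erefl (t x v)).
  by rewrite !inE (negPf n1) (negPf n2) (negPf n3) (negPf n4').
have Uxyzw : uniq [:: x; y; z; w].
  by rewrite /= !inE !negb_or xy xz xw (eq_sym y) zy (eq_sym y) wy eq_sym wz.
have cover v : v \in [:: x; y; z; w] by apply: uniq_cover; rewrite ?n4.
have xyw : t x w = y.
  have := cover (t x w).
  rewrite !inE (negPf (t_x _ _)) //= (negPf (t_free xw)) orbF.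
  by case/orP=> /eqP // /perm_inj e; rewrite e eqxx in wy.
have yx : y != x by rewrite eq_sym.
have tzx : t z x = t x (t y x) by have := quandle_distl x y x; rewrite t_idem.
have := cover (t y x); rewrite !inE (negPf (t_free yx)) /=.
rewrite -[X in _ == X](t_idem y) (inj_eq perm_inj) (negPf xy) /=.
case/orP=> /eqP tyx.
  have tzx' : t z x = w by rewrite tzx tyx.
  have := orbit4_firsts n4 xw; rewrite /= xyw tyx => u4.
  have := cover (t z y); move: u4; rewrite /= !inE !negb_or.
  case/and4P=> /and3P[_ _ /negPf n1] /andP[_ /negPf n2] /negPf n3 _.
  rewrite eq_sym n1 eq_sym n2 eq_sym n3 /= => /eqP.
  rewrite -tzx' => /perm_inj e.
  by rewrite e eqxx in xy.
have tzx' : t z x = y by rewrite tzx tyx.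
have := orbit4_firsts n4 xy; rewrite /= -/z tzx' => u4.
have := cover (t y z); move: u4; rewrite /= !inE !negb_or.
case/and4P=> /and3P[_ _ /negPf n1] /andP[_ /negPf n2] /negPf n3 _.
rewrite eq_sym n1 eq_sym n3 eq_sym n2 /= => /eqP; rewrite -tyx => /perm_inj e.
by rewrite e eqxx in xz.
Qed.

(** * Connected quandles: the dihedral structure *)

Lemma dvdn_double k : (n %| k.*2) = (n %| k).
Proof. by rewrite -mul2n Gauss_dvdr // coprime_sym coprime2n odd_card. Qed.

Lemma derangement_order d : d \in D -> #[d] = n.
Proof.
move=> dD; apply/eqP; rewrite eqn_dvd order_dvdn derangement_pow_eq1 //.
rewrite dvdn_double dvdnn /= -dvdn_double.
by rewrite -(derangement_pow_eq1 _ dD) expg_order.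
Qed.

(** The powers of [d] other than 1 have no fixed point, and [d] has order
    #|X| = #|D| + 1. *)
Lemma derangement_cycle d : d \in D -> <[d]> = 1 |: D.
Proof.
move=> dD; apply/eqP; rewrite eqEcard cardsU1 card_derangements.
rewrite -orderE (derangement_order dD) -{2}(prednK (ltnW X_gt1)).
rewrite -addn1 addnC leq_add2l leq_b1 andbT.
apply/subsetP=> _ /cycleP[i ->]; rewrite !inE -implyNb; apply/implyP=> di.
have dG : d \in G by move: dD; rewrite inE => /andP[].
rewrite groupX //=; apply/forallP=> x.
by rewrite (derangement_pow_fix _ _ dD) -(derangement_pow_eq1 _ dD).
Qed.

Lemma derangement_exists : exists d, d \in D.
Proof.
have /card_gt1P[x [y [_ _ xy]]] := X_gt1.
by exists (t y * t x); apply: prod_derangement.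
Qed.

(** All nontrivial elements of a cyclic group of order #|X| have that same
    order. *)
Lemma prime_card : prime n.
Proof.
have [d dD] := derangement_exists.
apply/primeP; split=> // e en.
have : d ^+ e \in 1 |: D by rewrite -(derangement_cycle dD) mem_cycle.
case/setU1P => [/eqP|deD].
  rewrite -order_dvdn (derangement_order dD) => ne.
  by rewrite (eqn_dvd e n) en ne orbT.
have := derangement_order deD.
rewrite orderXdiv (derangement_order dD) // => ee.
have n0 : 0 < n by apply: ltnW.
have := divnK en; rewrite ee => /eqP; rewrite -{2}(muln1 n) eqn_pmul2l //.
by move->.
Qed.

(** Products of two different translations lie in the cyclic group of the
    derangements; hence so does the square of [t x], which fixes [x]. *)
Lemma t_sqr x : t x * t x = 1.
Proof.
have [d dD] := derangement_exists; have eN := derangement_cycle dD.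
have prodN a b : a != b -> t b * t a \in <[d]>.
  by move=> ab; rewrite eN; apply/setU1P; right; apply: prod_derangement.
have [y xy] : exists y, x != y.
  by have [y] := t_nonconst x; exists y; apply: contraNneq p => ->.
have yz : y != t x y by rewrite eq_sym t_free.
have xz : x != t x y by rewrite -{1}(t_idem x) (inj_eq perm_inj).
have : t x * t x \in <[d]>.
  set z := t x y in xz yz.
  (* Three distinct points are needed to write the square in this way. *)
  have -> : t x * t x = (t x * t y) * (t z * t y)^-1 * (t z * t x).
    by rewrite invMg !mulgA mulgK mulgKV.
  by apply: groupM; [apply: groupM; rewrite ?groupV|]; apply: prodN;
    rewrite // eq_sym.
rewrite eN => /setU1P[//|]; rewrite inE => /andP[_ /forallP/(_ x)].
by rewrite permM !t_idem eqxx.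
Qed.

(** A derangement is a product of two involutions one of which is [t x]. *)
Lemma derangement_conj d x : d \in D -> d ^ t x = d^-1.
Proof.
case/(derangement_prod x) => y xy ->.
have tV z : (t z)^-1 = t z by apply/eqP; rewrite eq_invg_mul t_sqr.
by rewrite conjgE invMg !tV -!mulgA t_sqr mulg1.
Qed.

(** [t] maps d^i x to the conjugate of [t x] by d^i, and [t x] inverts [d]. *)
Lemma dihedral_pow d x i j m : d \in D -> m + j = i + i %[mod n] ->
  t ((d ^+ i) x) ((d ^+ j) x) = (d ^+ m) x.
Proof.
move=> dD mji; have dG : d \in G by move: dD; rewrite inE => /andP[].
rewrite inn_aut ?groupX // -{1}(mulgKV (d ^+ i) (d ^+ j)).
rewrite (permM (_ * _^-1)) permJ -!permM ?mulgA.
set e := _ * _^-1; have -> : e * t x = t x * e^-1.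
  have /cycleP[k ->] : e \in <[d]> by rewrite groupM ?groupV ?mem_cycle.
  by rewrite conjgC conjXg derangement_conj // expgVn.
rewrite -mulgA permM t_idem; congr (fun_of_perm _ x).
rewrite /e invMg invgK; apply: (mulIg (d ^+ j)).
rewrite -mulgA -[d ^+ i * d ^+ j]expgD addnC expgD mulgA mulgKV -!expgD.
by apply/eqP; rewrite eq_expg_mod_order derangement_order // mji.
Qed.

Lemma derangement_pow_inj d x i j : d \in D ->
  (d ^+ i) x = (d ^+ j) x -> i = j %[mod n].
Proof.
move=> dD; wlog ij : i j / i <= j => [th|].
  by case/orP: (leq_total i j) => h e; [|apply/esym]; apply: th.
rewrite -{1}(subnK ij) expgD permM => /perm_inj/esym/eqP.
rewrite derangement_pow_fix // dvdn_double => h.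
by apply/esym/eqP; rewrite eqn_mod_dvd.
Qed.

End Transitive.

(** In the third case, the points d^i x are labelled by the residues i modulo
    #|X|, and the quandle operation is (i, j) |-> 2 i - j. *)
Theorem quandle_classification :
  [\/ two_trivial, three_transposition
    | [/\ odd #|X|, prime #|X| & exists d : {perm X}, exists x : X,
        (forall i j, (d ^+ i) x = (d ^+ j) x -> i = j %[mod #|X|]) /\
        (forall i j m, m + j = i + i %[mod #|X|] ->
           t ((d ^+ i) x) ((d ^+ j) x) = (d ^+ m) x)]].
Proof.
have [/existsP[x /exists_inP[h hG thx]] | ] :=
    boolP [exists x, exists h in G, t (h x) != t x]; last first.
  rewrite negb_exists => /forallP t_inn.
  have [||] := intransitive_quandle; [|by constructor 1 | by constructor 2].
  move=> x h hG; apply/eqP; have := t_inn x; rewrite negb_exists_in.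
  by move/forall_inP/(_ h hG)/negPn.
have t_trans := conn_transitive hG thx.
have [d dD] := derangement_exists t_trans.
constructor 3; split; [exact: odd_card | exact: prime_card |].
exists d, x; split=> i j; first exact: derangement_pow_inj.
by move=> m; apply: dihedral_pow.
Qed.

End Quandle.

(** * Moves on words *)

Section WordMoves.

Variables (X : finType) (r : X * X -> X * X).

(** Words that are too short are left unchanged, which keeps [act_at i] total
    and compatible with [cons]. *)
Fixpoint act_at i (s : seq X) :=
  match i, s with
  | 0, x :: y :: s' => (r (x, y)).1 :: (r (x, y)).2 :: s'
  | i'.+1, x :: s' => x :: act_at i' s'
  | _, _ => s
  end.

Lemma size_act_at i s : size (act_at i s) = size s.
Proof. by elim: i s => [|i IHi] [|x [|y s]] //=; rewrite IHi. Qed.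

Lemma act_at_cat s1 x y s2 :
  act_at (size s1) (s1 ++ x :: y :: s2) =
    s1 ++ (r (x, y)).1 :: (r (x, y)).2 :: s2.
Proof. by elim: s1 => //= z s1 ->. Qed.

Lemma act_at_oversize i s : size s <= i -> act_at i s = s.
Proof. by elim: i s => [|i IHi] [|x s] //= /IHi->. Qed.

Variable m : nat.

Definition word_move (u v : m.-tuple X) :=
  [exists i : 'I_m, val v == act_at i u].
Definition word_adj u v := word_move u v || word_move v u.

Lemma word_adj_sym : connect_sym word_adj.
Proof. by apply: sym_connect_sym => u v; rewrite /word_adj orbC. Qed.

Definition num_classes := n_comp word_adj predT.

End WordMoves.

Section ClassRepresentatives.

Import GRing.Theory.
Local Open Scope ring_scope.

Variables (T : finType) (e : rel T).
Hypothesis e_sym : connect_sym e.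

Definition class_rep (i : 'I_(n_comp e predT)) : T := enum_val i.

Lemma class_rep_root i : fingraph.root e (class_rep i) = class_rep i.
Proof. by apply/eqP; have := enum_valP i; rewrite inE => /andP[]. Qed.

Lemma class_rep_onto x : exists i, class_rep i = fingraph.root e x.
Proof.
have rx : fingraph.root e x \in [predI roots e & predT].
  by rewrite !inE roots_root.
exists (enum_rank_in rx (fingraph.root e x)).
by rewrite /class_rep enum_rankK_in.
Qed.

(** The coefficients are added up over each connected component of [e]. *)
Lemma span_class_rep (K : fieldType) (V : lmodType K) (v : T -> V) :
    (forall x y, connect e x y -> v x = v y) ->
  forall u, span_of v u <-> span_of (fun i => v (class_rep i)) u.
Proof.
move=> ve u; split=> -[c ->].
  exists (fun i => \sum_(x | fingraph.root e x == class_rep i) c x).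
  under [RHS]eq_bigr => i _ do rewrite scaler_suml.
  rewrite (exchange_big_dep predT) //=; apply: eq_bigr => x _.
  have [i xi] := class_rep_onto x.
  rewrite (big_pred1 i) => [|j /=]; last first.
    by rewrite eq_sym -xi (inj_eq enum_val_inj).
  by rewrite xi (ve x (fingraph.root e x)) // connect_root.
exists (fun x => \sum_(i | class_rep i == x) c i).
under [RHS]eq_bigr => i _ do rewrite scaler_suml.
rewrite (exchange_big_dep predT) //=; apply: eq_bigr => i _.
by rewrite (big_pred1 (class_rep i)) // => x /=; rewrite eq_sym.
Qed.

End ClassRepresentatives.

(** * Dimensions of the graded parts of a structure algebra *)

Section GradedDimension.

Import GRing.Theory.
Local Open Scope ring_scope.
Local Open Scope quotient_scope.

(** This identity and the next one are stated over an abstract ring, so that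
    the convolution product of the monoid algebra need not be unfolded when they
    are applied to it. *)
Lemma mulr3D (R : nzRingType) (a p q b : R) :
  a * (p + q) * b = a * p * b + a * q * b.
Proof. by rewrite mulrDr mulrDl. Qed.

Lemma mulr4A (R : nzRingType) (a p q b : R) :
  a * (p * q) * b = a * p * (q * b).
Proof. by rewrite !mulrA. Qed.

Variables (K : fieldType) (X : finType) (r : X * X -> X * X).

Local Notation A := (structure_algebra K r).
Local Notation F := {malg K[{fmonom X}]}.
Local Notation rel := (structure_relation (K := K) r).

Definition word_mon (s : seq X) : F := << FMonom s >>.
Definition word_val (s : seq X) : A := \prod_(x <- s) structure_var K r x.

Lemma word_mon_cat s1 s2 : word_mon (s1 ++ s2) = word_mon s1 * word_mon s2.
Proof.
rewrite /word_mon malgM_def fgmulUU mulr1; congr << _ *g _ >>.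
by apply/esym; exact: fmmulE.
Qed.

Lemma word_mon1 x : free_var K x = word_mon [:: x].
Proof. by rewrite /free_var fmuE. Qed.

Lemma malgU_word c k : << c *g k >> = c *: word_mon k :> F.
Proof.
by apply/malgP => k'; rewrite mcoeffZ /word_mon fmK !mcoeffU mulr_natr.
Qed.

Lemma malgU_word_mul c k s d l :
  << c *g k >> * word_mon s * << d *g l >> = (c * d) *: word_mon (k ++ s ++ l).
Proof.
rewrite -(malgU_word (c * d) (FMonom (k ++ s ++ l))) /word_mon.
rewrite !malgM_def !fgmulUU mulr1.
congr << _ *g _ >>; apply/val_inj.
by rewrite [mmul _ l]fmmulE /= [mmul k _]fmmulE /= catA.
Qed.

Lemma malgU_word_mulB c k s s' d l :
  << c *g k >> * (word_mon s - word_mon s') * << d *g l >> =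
    (c * d) *: (word_mon (k ++ s ++ l) - word_mon (k ++ s' ++ l)).
Proof.
rewrite scalerBr -!malgU_word_mul.
by apply: etrans (mulrBl _ _ _); congr (_ * _); apply: mulrBr.
Qed.

Lemma piE s : word_val s = \pi_A (word_mon s).
Proof.
elim: s => [|x s IHs].
  rewrite /word_val big_nil /word_mon (_ : << _ >> = 1) //.
  by congr << _ *g _ >>; rewrite -fmoneE.
rewrite /word_val big_cons -/(word_val s) IHs -cat1s word_mon_cat -word_mon1.
exact/esym/pi_quot_mul.
Qed.

Lemma pi_eq (p q : F) :
  \pi_A p = \pi_A q <-> ideal_gen rel (p - q).
Proof.
split=> [/eqP|h].
  by rewrite -(Quotient.idealrBE (ideal_zmod rel)) => /ideal_predP.
by apply/eqP; rewrite -(Quotient.idealrBE (ideal_zmod rel)); apply/ideal_predP.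
Qed.

Lemma pi0 : \pi_A (0 : F) = 0.
Proof. exact: pi_zeror. Qed.

Lemma pi_sum (I : finType) (k : I -> K) (p : I -> F) :
  \pi_A (\sum_i k i *: p i) = \sum_i k i *: \pi_A (p i).
Proof.
rewrite (big_morph (\pi_A : F -> A) (id1 := 0) (op1 := +%R)).
- by apply: eq_bigr => i _; exact: pi_quot_scale.
- exact: (Quotient.pi_add (ideal_zmod rel)).
exact: pi0.
Qed.

Lemma word_val_pair x y :
  word_val [:: x; y] = word_val [:: (r (x, y)).1; (r (x, y)).2].
Proof.
rewrite !piE; apply/pi_eq/ideal_gen_in; exists x, y.
by rewrite !word_mon1 -!word_mon_cat.
Qed.

Lemma word_val_cat s1 s2 : word_val (s1 ++ s2) = word_val s1 * word_val s2.
Proof. exact: big_cat. Qed.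

Lemma word_val_act_at i s : word_val (act_at r i s) = word_val s.
Proof.
elim: i s => [|i IHi] [|x s] //=.
  case: s => // y s.
  have e2 z t : word_val [:: z, t & s] = word_val [:: z; t] * word_val s.
    exact: word_val_cat [:: z; t] s.
  apply: etrans (e2 _ _) _; apply: etrans (esym (e2 x y)).
  exact: (congr1 (fun a : A => a * word_val s) (esym (word_val_pair x y))).
have e1 t : word_val (x :: t) = word_val [:: x] * word_val t.
  exact: word_val_cat [:: x] t.
by apply: etrans (e1 _) _; apply: etrans (esym (e1 _)); rewrite IHi.
Qed.

Section Functional.

Variables (m : nat) (c : m.-tuple X).

Local Notation adj := (@word_adj X r m).

(** These linear forms descend to the structure algebra, where they separate
    the classes of words. *)
Definition class_coeff (p : F) : K :=
  \sum_(w : m.-tuple X | fingraph.root adj w == c) p@_(FMonom w).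

Lemma class_coeffD p q : class_coeff (p + q) = class_coeff p + class_coeff q.
Proof. by rewrite -big_split; apply: eq_bigr => w _; rewrite mcoeffD. Qed.

Lemma class_coeffZ k p : class_coeff (k *: p) = k * class_coeff p.
Proof. by rewrite big_distrr; apply: eq_bigr => w _; rewrite mcoeffZ. Qed.

Lemma class_coeffB p q : class_coeff (p - q) = class_coeff p - class_coeff q.
Proof. by rewrite -scaleN1r class_coeffD class_coeffZ mulN1r. Qed.

Lemma class_coeff0 : class_coeff 0 = 0.
Proof. by rewrite /class_coeff big1 // => w _; rewrite mcoeff0. Qed.

Lemma class_coeff_sum (I : Type) (s : seq I) P (f : I -> F) :
  class_coeff (\sum_(i <- s | P i) f i) = \sum_(i <- s | P i) class_coeff (f i).
Proof. exact: (big_morph _ class_coeffD class_coeff0). Qed.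

Lemma class_coeff_word (w : m.-tuple X) :
  class_coeff (word_mon w) = (fingraph.root adj w == c)%:R.
Proof.
rewrite /class_coeff big_mkcond (bigD1 w) //= big1 ?addr0 => [|v vw].
  by rewrite /word_mon mcoeffU1 eqxx; case: ifP.
rewrite /word_mon mcoeffU1 (_ : (FMonom w == FMonom v) = false) ?if_same //.
by apply: contraNF vw => /eqP[e]; apply/eqP/val_inj.
Qed.

Lemma class_coeff_size (s : seq X) :
  size s != m -> class_coeff (word_mon s) = 0.
Proof.
move=> sm; rewrite /class_coeff big1 // => w _; rewrite /word_mon mcoeffU1.
rewrite -(inj_eq val_inj) /=; case: eqP => // sw.
by rewrite sw size_tuple eqxx in sm.
Qed.

Lemma class_coeff_act_at i (s : seq X) :
  class_coeff (word_mon (act_at r i s)) = class_coeff (word_mon s).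
Proof.
have [si|is_] := leqP (size s) i; first by rewrite act_at_oversize.
have [sm|sm] := eqVneq (size s) m; last first.
  by rewrite !class_coeff_size ?size_act_at.
have sm' : size (act_at r i s) == m by rewrite size_act_at sm.
have := class_coeff_word (Tuple sm'); rewrite /= => ->.
have := class_coeff_word (Tuple (introT eqP sm)); rewrite /= => ->.
congr (_ == _)%:R; apply/esym/eqP.
rewrite (root_connect (@word_adj_sym X r m)); apply/connect1/orP; left.
by rewrite sm in is_; apply/existsP; exists (Ordinal is_).
Qed.

(** The products of a defining relation with monomials on both sides are
    differences of words that are one move apart.  For the induction over the
    ideal, the claim is strengthened to two-sided multiples of [p]. *)
Lemma class_coeff_ideal p :
  ideal_gen rel p -> class_coeff p = 0.
Proof.
suffices H : ideal_gen rel p ->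
    forall a b : F, class_coeff (a * p * b) = 0.
  by move=> /H/(_ 1 1); rewrite mul1r mulr1.
elim=> {p} [p [x [y ->]]||p q _ IHp _ IHq|e p _ IHp|e p _ IHp] a b.
- rewrite !word_mon1 -!word_mon_cat; set q := _ - _.
  rewrite [a]monalgE [b]monalgE [X in class_coeff X]mulr_sumr.
  rewrite class_coeff_sum big1 // => l _.
  have -> : (\sum_(k <- msupp a) << a@_k *g k >>) * q =
            \sum_(k <- msupp a) << a@_k *g k >> * q.
    exact: mulr_suml.
  rewrite [X in class_coeff X]mulr_suml class_coeff_sum big1 // => k _.
  rewrite /q malgU_word_mulB class_coeffZ class_coeffB.
  by rewrite -(class_coeff_act_at (size k) (k ++ _)) act_at_cat subrr mulr0.
- by rewrite mulr0 mul0r class_coeff0.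
- apply: etrans (congr1 class_coeff (mulr3D a p q b)) _.
  apply: etrans (class_coeffD _ _) _.
  exact: etrans (congr2 +%R (IHp a b) (IHq a b)) (addr0 0).
- apply: etrans (congr1 (fun u => class_coeff (u * b)) (mulrA a e p)) _.
  exact: IHp (a * e) b.
exact: etrans (congr1 class_coeff (mulr4A a p e b)) (IHp a (e * b)).
Qed.

End Functional.

Section Dimension.
Variable m : nat.
Local Notation adj := (@word_adj X r m).

Lemma connect_word_val (u v : m.-tuple X) :
  connect adj u v -> word_val u = word_val v.
Proof.
case/connectP => p; elim: p u => [|w p IHp] u /= => [_ ->//|/andP[uw pw] ev].
by rewrite -(IHp _ pw ev); case/orP: uw => /existsP[i /eqP->];
  rewrite word_val_act_at.
Qed.

(** One word from each class is a basis: words in a class have the same value,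
    and the forms [class_coeff] are dual to the chosen words. *)
Lemma graded_part_dim : has_dim (graded_part K r m) (num_classes r m).
Proof.
pose b := @class_rep _ adj; have cV : connect_sym adj := @word_adj_sym X r m.
exists (fun i => word_val (b i)); split; last first.
  pose v (w : m.-tuple X) := word_val w.
  exact: (span_class_rep cV (v := v) connect_word_val).
move=> c c0 i; pose p : F := \sum_j c j *: word_mon (b j).
have /(class_coeff_ideal (b i)) : ideal_gen rel p.
  rewrite -[p]subr0; apply/pi_eq; rewrite pi_sum.
  under eq_bigr => j _ do rewrite -piE.
  by rewrite c0 pi0.
rewrite class_coeff_sum (bigD1 i) //= big1 ?addr0 => [|j ji].
  by rewrite class_coeffZ class_coeff_word class_rep_root eqxx mulr1.
rewrite class_coeffZ class_coeff_word class_rep_root (inj_eq enum_val_inj).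
by rewrite (negPf ji) mulr0.
Qed.

End Dimension.
End GradedDimension.

(** * The guitar map and the derived solution *)

Section DerivedSolution.

Variables (X : finType) (r : X * X -> X * X).
Hypotheses (r_braided : braided r) (r_nondeg : non_degenerate r).

Local Notation sigma := (sigma r).
Local Notation gamma := (gamma r).
Local Notation r' := (derived r).

(** The second and third components of the braid relation. *)
Lemma braided_ybe x y z :
  [/\ gamma (sigma (gamma y x) z) (sigma x y) =
        sigma (gamma (sigma y z) x) (gamma z y) &
      gamma z (gamma y x) = gamma (gamma z y) (gamma (sigma y z) x)].
Proof. by have /= [_ e2 e3] := r_braided (x, y, z). Qed.

Lemma gamma_inj y : injective (gamma y).
Proof. by have [_ /bij_inj] := r_nondeg y. Qed.

Lemma gamma_onto y x : exists a, x = gamma y a.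
Proof. by have [_ [g _ gK]] := r_nondeg y; exists (g x). Qed.

(** Replacing x by gamma_y(a) removes the inverse in the definition of the
    derived solution. *)
Lemma derivedE a y :
  r' (gamma y a, y) = (gamma (gamma y a) (sigma a y), gamma y a).
Proof. by rewrite /derived finv_f //; apply: gamma_inj. Qed.

(** The second and third components of the braid relation at (a, y, z), where
    x = gamma_y(a), and the third one at the image of (a, y) under [r]. *)
Lemma derived_gamma z x y :
  r' (gamma z x, gamma z y) = (gamma z (r' (x, y)).1, gamma z (r' (x, y)).2).
Proof.
have [a ->] := gamma_onto y x; have [e2 e3] := braided_ybe a y z.
rewrite derivedE e3 derivedE -e3 -e2.
by have [_ <-] := braided_ybe (sigma a y) (gamma y a) z.
Qed.

Definition gamma_word (x : X) (s : seq X) := foldl (fun a y => gamma y a) x s.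

Fixpoint guitar (s : seq X) :=
  if s is x :: s' then gamma_word x s' :: guitar s' else [::].

Lemma size_guitar s : size (guitar s) = size s.
Proof. by elim: s => //= x s ->. Qed.

Lemma gamma_word_inj s : injective (gamma_word^~ s).
Proof. by elim: s => [|y s IHs] x z //= /IHs/gamma_inj. Qed.

Lemma guitar_inj : injective guitar.
Proof.
elim=> [|x s IHs] [|y u] //= [e /IHs su].
by move: e; rewrite su => /gamma_word_inj ->.
Qed.

(** By the third component of the braid relation, the composites of the
    gammas do not see a move. *)
Lemma gamma_word_act_at i x s : gamma_word x (act_at r i s) = gamma_word x s.
Proof.
rewrite /gamma_word; elim: i x s => [|i IHi] x [|y s] //=.
case: s => //= z s; by have [_ <-] := braided_ybe x y z.
Qed.

Lemma derived_gamma_word x y s :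
  r' (gamma_word x s, gamma_word y s) =
  (gamma_word (r' (x, y)).1 s, gamma_word (r' (x, y)).2 s).
Proof.
elim: s x y => [|z s IHs] x y; first by rewrite /gamma_word -surjective_pairing.
have gwE a : gamma_word a (z :: s) = gamma_word (gamma z a) s by [].
by rewrite !gwE IHs derived_gamma.
Qed.

(** The two letters that are moved are treated by [derivedE], and the letters
    on their right act on them by automorphisms of the derived solution; the
    letters on their left do not see the move. *)
Lemma guitar_act_at i s : guitar (act_at r i s) = act_at r' i (guitar s).
Proof.
elim: i s => [|i IHi] [|x s] //; last by rewrite /= gamma_word_act_at IHi.
case: s => // y s.
have gE a b u : guitar [:: a, b & u] =
  [:: gamma_word (gamma b a) u, gamma_word b u & guitar u] by [].
have aE f a b u : act_at f 0 [:: a, b & u] =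
  [:: (f (a, b)).1, (f (a, b)).2 & u] :> seq X by [].
by rewrite aE !gE aE derived_gamma_word derivedE.
Qed.

Definition guitar_tuple m (w : m.-tuple X) : m.-tuple X :=
  Tuple (introT eqP (etrans (size_guitar w) (size_tuple w))).

Lemma guitar_tuple_inj m : injective (@guitar_tuple m).
Proof. by move=> u v /(congr1 val)/guitar_inj/val_inj. Qed.

Lemma word_adj_guitar m (u v : m.-tuple X) :
  word_adj r' (guitar_tuple u) (guitar_tuple v) = word_adj r u v.
Proof.
have mv (a b : m.-tuple X) :
  word_move r' (guitar_tuple a) (guitar_tuple b) = word_move r a b.
  by apply: eq_existsb => i; rewrite /= -guitar_act_at (inj_eq guitar_inj).
by rewrite /word_adj !mv.
Qed.

Lemma num_classes_derived m : num_classes r m = num_classes r' m.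
Proof.
apply/esym; apply: (adjunction_n_comp (@guitar_tuple m)) => //.
- exact: word_adj_sym.
- exact: word_adj_sym.
apply: strict_adjunction => //.
- exact: word_adj_sym.
- exact: guitar_tuple_inj.
- by apply/subsetP => w _; apply: injF_onto; apply: guitar_tuple_inj.
by move=> u v _; rewrite word_adj_guitar.
Qed.

Definition guitar3 t :=
  let: (x, y, z) := t in (gamma z (gamma y x), gamma z y, z).

(** The guitar map on three letters is onto and conjugates the braid relation
    of [r] into that of the derived solution. *)
Lemma derived_braided : braided r'.
Proof.
have g1 t : r1 r' (guitar3 t) = guitar3 (r1 r t).
  by case: t => -[x y] z; rewrite /r1 /guitar3 derived_gamma derivedE.
have g2 t : r2 r' (guitar3 t) = guitar3 (r2 r t).
  case: t => -[x y] z; rewrite /r2 /guitar3 derivedE.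
  by have [_ ->] := braided_ybe x y z.
move=> [[x y] z]; have [b ->] := gamma_onto z y.
have [a' ->] := gamma_onto z x; have [a ->] := gamma_onto b a'.
rewrite -[(_, _, z)]/(guitar3 (a, b, z)) /comp !(g1, g2).
by have := r_braided (a, b, z); rewrite /comp => ->.
Qed.

Lemma derived_inj : injective r -> injective r'.
Proof.
move=> r_inj [x y] [x' y'].
have [a ->] := gamma_onto y x; have [a' ->] := gamma_onto y' x'.
rewrite !derivedE => -[e1 e2]; rewrite e2 in e1; have e3 := gamma_inj e1.
suffices /r_inj[-> ->] : r (a, y) = r (a', y') by [].
by rewrite [LHS]surjective_pairing [RHS]surjective_pairing; congr (_, _).
Qed.

Definition derived_act x y := (r' (x, y)).1.

Lemma derived_act_inj : injective r -> forall x, injective (derived_act x).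
Proof.
move=> r_inj x y z e; have [] // : (x, y) = (x, z).
by apply: (derived_inj r_inj); rewrite /derived; congr (_, _).
Qed.

Lemma derived_act_dist x y z :
  derived_act (derived_act x y) (derived_act x z) =
    derived_act x (derived_act y z).
Proof. by have [] := derived_braided (x, y, z). Qed.

Lemma derived_act_idem : square_free r -> forall x, derived_act x x = x.
Proof.
move=> sf x; have gx : gamma x x = x by rewrite /gamma sf.
by rewrite /derived_act -{1}gx derivedE gx /Defs.sigma sf.
Qed.

End DerivedSolution.

(** * The classification *)

Section Isomorphisms.

Import GRing.Theory.
Local Open Scope ring_scope.

Variables (X : finType) (s : X * X -> X * X) (t : X -> {perm X}).
Hypothesis sE : forall x y, s (x, y) = (t x y, x).

Lemma two_trivial_iso : two_trivial t -> isomorphic s (@trivial_sol X).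
Proof.
move=> [_ t1]; exists id; first by exists id.
by move=> x y; rewrite sE t1 perm1.
Qed.

Lemma three_transposition_iso :
  three_transposition t -> prime #|X| /\ isomorphic s transposition_sol.
Proof.
move=> [a [b [c [abc cover ta tb tc]]]].
have X3 : #|X| = 3%N.
  rewrite -[3%N]/(size [:: a; b; c]) -(card_uniqP abc).
  by apply/eq_card=> x; rewrite cover.
have [ab ac bc] : [/\ b == a = false, c == a = false & c == b = false].
  move: abc; rewrite /= !inE negb_or -andbA => /and4P[n1 n2 n3 _].
  by rewrite ![_ == a]eq_sym [c == b]eq_sym (negPf n1) (negPf n2) (negPf n3).
split; first by rewrite X3.
pose f x : 'I_3 := if x == a then 0 else if x == b then 1 else 2.
have fa : f a = 0 by rewrite /f eqxx.
have fb : f b = 1 by rewrite /f ab eqxx.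
have fc : f c = 2 by rewrite /f ac bc.
have cases (P : X -> Prop) : P a -> P b -> P c -> forall x, P x.
  by move=> Pa Pb Pc x; move: (cover x); rewrite !inE => /or3P[]/eqP->.
have f_inj : injective f.
  by apply: (cases _); apply: (cases _); rewrite ?fa ?fb ?fc //; case.
exists f; first by apply: (inj_card_bij f_inj); rewrite X3 card_ord.
have tca : tperm a b c = c by rewrite tpermD // eq_sym ?ac ?bc.
move=> x y; rewrite sE /transposition_sol /=; congr (_, _); move: x y.
apply: (cases _); apply: (cases _);
  rewrite ?ta ?tb ?tc ?perm1 ?tpermL ?tpermR ?tca ?fa ?fb ?fc //=.
- by rewrite tpermL.
- by rewrite tpermR.
by rewrite tpermD.
Qed.

Lemma dihedral_iso (d : {perm X}) (x : X) : prime #|X| ->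
    (forall i j, (d ^+ i)%g x = (d ^+ j)%g x -> i = j %[mod #|X|]) ->
    (forall i j m, (m + j = i + i %[mod #|X|])%N ->
       t ((d ^+ i)%g x) ((d ^+ j)%g x) = (d ^+ m)%g x) ->
  isomorphic s (@dihedral_sol #|X|).
Proof.
move=> pX d_inj d_act; have X1 := prime_gt1 pX.
pose g (i : 'Z_#|X|) := (d ^+ i)%g x.
have valZ (i : 'Z_#|X|) : (i %% #|X|)%N = i.
  by rewrite modn_small // -[X in (_ < X)%N](Zp_cast X1) ltn_ord.
have g_inj : injective g.
  by move=> i j /d_inj; rewrite !valZ => /val_inj.
have [f fK gK] : bijective g.
  by apply: inj_card_bij g_inj _; rewrite card_ord Zp_cast.
exists f; first by exists g.
move=> u v; rewrite sE /= /dihedral_sol; congr (_, _).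
rewrite -{1}[u]gK -{1}[v]gK /g; set i := f u; set j := f v.
pose k : 'Z_#|X| := i *+ 2 - j.
rewrite (d_act _ _ k); first exact: (fK k).
have /(congr1 val) : (k + j)%N%:R = (i + i)%N%:R :> 'Z_#|X|.
  by rewrite !natrD !natr_Zp subrK mulr2n.
by rewrite /= !val_Zp_nat.
Qed.

End Isomorphisms.

Theorem corollary5p6 (X : finType) (r : {perm X * X})
    (r_braided : braided r) (r_nondeg : non_degenerate r)
    (r_square_free : square_free r) (X_gt1 : (1 < #|X|)%N)
    (r_orbits : #|porbits r| = (2 * #|X| - 1)%N) :
  [/\ prime #|X|,
      [\/ [/\ odd #|X|, prime #|X| &
              isomorphic (derived r) (@dihedral_sol #|X|)],
          #|X| = 2%N /\ isomorphic (derived r) (@trivial_sol X)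
        | isomorphic (derived r) transposition_sol]
    & forall (K : fieldType) (m : nat), exists d : nat,
        has_dim (graded_part K r m) d /\ has_dim (graded_part K (derived r) m) d].
Proof.
have r_inj : injective r := @perm_inj _ r.
pose t x := perm (derived_act_inj r_nondeg r_inj (x := x)).
have tE x y : t x y = derived_act r x y by rewrite permE.
have sE x y : derived r (x, y) = (t x y, x) by rewrite tE.
have t_idem x : t x x = x by rewrite tE; apply: derived_act_idem.
have t_dist x y : t (t x y) = (t y ^ t x)%g.
  apply/permP=> z; rewrite -[z](permKV (t x)) permJ !tE.
  exact: derived_act_dist.
have guitar_inj2 : injective (fun p : X * X => (gamma r p.2 p.1, p.2)).
  by move=> [a y] [a' y'] /= [+ e]; rewrite e => /(gamma_inj r_nondeg) ->.
(* The guitar map on two letters conjugates [r] into the braiding of [t]. *)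
have quandle_orbits : #|porbits (quandle_sol t)| = (2 * #|X| - 1)%N.
  rewrite -r_orbits -(card_porbits_conj r (perm guitar_inj2)).
  congr #|pred_of_set (porbits _)|; apply/permP=> p.
  have [[a y] ->] : exists q, p = perm guitar_inj2 q.
    by exists ((perm guitar_inj2)^-1%g p); rewrite permKV.
  by rewrite permJ !permE /= -[quandle_fun _ _]sE derivedE.
have dims (K : fieldType) m : exists d : nat,
    has_dim (graded_part K r m) d /\ has_dim (graded_part K (derived r) m) d.
  exists (num_classes r m); split; first exact: graded_part_dim.
  by rewrite num_classes_derived //; apply: graded_part_dim.
case: (quandle_classification t_idem t_dist quandle_orbits X_gt1).
- move=> h; have [X2 _] := h; split; rewrite ?X2 //.
  by constructor 2; split; last exact: two_trivial_iso h.
- by case/(three_transposition_iso sE) => pX iso; split=> //; constructor 3.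
case=> oX pX [d [x [d_inj d_act]]]; split=> //; constructor 1; split=> //.
exact: dihedral_iso d_inj d_act.
Qed.
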